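(* Let $G=(V,E)$ be a finite simple undirected graph with clique-degree $D$, and let $\mathcal{G}$ be an integral graphical potential game on $G$ with $M$-bounded local potentials. Then the number of times that a player $k\in V$ updates her strategy in any better-response path is at most $$2DM\sum_{r=0}^{\infty}\left(1-\frac{1}{2DM}\right)^r S_r(G,k).$$
   Context: A game has a finite player set $V$; each player $i\in V$ has a finite strategy set $\mathcal{S}_i$; $\mathcal{S}=\prod_{i\in V}\mathcal{S}_i$ is the set of strategy profiles; player $i$ has a utility $u_i\colon\mathcal{S}\to\mathbb{R}$. It is a graphical game on $G$ if each $u_i(a)$ depends only on the strategies of $i$ and of the neighbors of $i$ in $G$. It is a potential game with potential $\Phi\colon\mathcal{S}\to\mathbb{R}$ if $u_i(b)-u_i(a)=\Phi(b)-\Phi(a)$ whenever $a,b\in\mathcal{S}$ differ only in coordinate $i$. A graphical potential game on $G$ is a game that is both. $\mathcal{C}(G)$ is the set of maximal cliques of $G$ (cliques not contained in strictly larger cliques). For $C\subseteq V$, $a^C$ is the restriction of $a\in\mathcal{S}$ to $C$. The potential (not required to be normalized in any way) comes with a decomposition $\Phi(a)=\sum_{C\in\mathcal{C}(G)}\Phi^C(a^C)$ into local potentials $\Phi^C\colon\prod_{i\in C}\mathcal{S}_i\to\mathbb{R}$. The game has $M$-bounded local potentials if $|\Phi^C(a^C)|\le M$ for all $C$ and all $a^C$, and is integral if all local potentials (of this decomposition) take only integer values. The clique-degree of $G$ is the largest number of maximal cliques to which any single vertex belongs. A better-response path of length $L$ is a sequence of profiles $(a(t))_{t=0}^{L}$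 such that for each $t<L$, $a(t+1)$ differs from $a(t)$ in exactly one coordinate $i=i(t)$ and $u_{i}(a(t+1))>u_{i}(a(t))$; player $i(t)$ is said to update her strategy at time $t$. $S_r(G,k)$ is the number of vertices at graph distance exactly $r$ from $k$ in $G$.
   Formalization: The theorem assumes 2DM ≥ 1; for 0 < M < 1/(2D) all local potentials vanish and the bound can be negative (e.g. K_2, M = 1/10, zero potentials: 0 updates but bound −0.6), and for M = 0 the formula is undefined. *)

(* Defs.v *)
From mathcomp Require Import all_boot all_order all_algebra.
From mathcomp Require Import all_classical all_reals all_analysis.

Set Implicit Arguments.
Unset Strict Implicit.
Unset Printing Implicit Defensive.

Import Order.TTheory GRing.Theory Num.Theory.
Import numFieldNormedType.Exports.

Local Open Scope ring_scope.

Section Graph.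
Variables (V : finType) (e : rel V).

Definition is_clique (C : {set V}) : bool :=
  [forall x in C, forall y in C, (x != y) ==> e x y].

Definition max_cliques : {set {set V}} := [set C | maxset is_clique C].

Definition clique_degree : nat :=
  \max_(v : V) #|[set C in max_cliques | v \in C]|.

Definition has_walk (r : nat) (x y : V) : bool :=
  [exists p : r.-tuple V, path e x p && (last x p == y)].

(* Vertices in another component than k are at no finite distance, so they
   lie on no sphere around k. *)
Definition at_dist (r : nat) (x y : V) : bool :=
  has_walk r x y && [forall s : 'I_r, ~~ has_walk s x y].

Definition sphere_size (k : V) (r : nat) : nat := #|[set v | at_dist r k v]|.

End Graph.

Section Game.
Variables (R : realType) (V : finType) (S : V -> finType).

Definition profile : Type := {dffun forall i : V, S i}.

Definition local_profile (C : {set V}) : Type :=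
  {dffun forall i : {j : V | j \in C}, S (val i)}.

Definition restrict (C : {set V}) (a : profile) : local_profile C :=
  [ffun i : {j : V | j \in C} => a (val i)].

Definition agree_off (i : V) (a b : profile) : bool :=
  [forall j, (j != i) ==> (a j == b j)].

Definition graphical_game (e : rel V) (u : V -> profile -> R) : Prop :=
  forall (i : V) (a b : profile),
    a i = b i -> (forall j, e i j -> a j = b j) -> u i a = u i b.

Definition is_potential (u : V -> profile -> R) (Phi : profile -> R) : Prop :=
  forall (i : V) (a b : profile),
    agree_off i a b -> u i b - u i a = Phi b - Phi a.

(* A family of local potentials is indexed by all sets of players, but only its
   members at maximal cliques are ever used. *)
Definition local_potentials : Type := forall C : {set V}, local_profile C -> R.

Definition decomposes (e : rel V) (Phi : profile -> R)
    (phi : local_potentials) : Prop :=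
  forall a : profile, Phi a = \sum_(C in max_cliques e) phi C (restrict C a).

Definition bounded_local_potentials (e : rel V) (phi : local_potentials)
    (M : R) : Prop :=
  forall C : {set V}, C \in max_cliques e ->
  forall x : local_profile C, `|phi C x| <= M.

Definition integral_local_potentials (e : rel V)
    (phi : local_potentials) : Prop :=
  forall C : {set V}, C \in max_cliques e ->
  forall x : local_profile C, phi C x \is a Num.int.

Definition better_response (u : V -> profile -> R) (i : V) (a b : profile)
    : bool :=
  [&& agree_off i a b, a i != b i & u i a < u i b].

(* Only the values a 0, ..., a L of the sequence matter. *)
Definition better_response_path (u : V -> profile -> R) (a : nat -> profile)
    (L : nat) : Prop :=
  forall t, (t < L)%N -> exists i, better_response u i (a t) (a t.+1).

Definition num_updates (u : V -> profile -> R) (a : nat -> profile)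
    (L : nat) (k : V) : nat :=
  #|[set t : 'I_L | better_response u k (a t) (a t.+1)]|.

End Game.

(* Main.v *)
(** Let q = 1 - 1/(2DM), give a vertex at distance d from k the weight q^d
    (and 0 if it is unreachable), give a clique the largest weight of its
    vertices, and consider the sum Psi of the local potentials with these
    weights. An update of player i changes Phi by an integer, hence by at least
    1, and the weights of the cliques at i differ from that of i by a factor at
    most 1/q; this makes Psi nondecreasing along the path. The cliques at k all
    have weight 1, so an update of k increases Psi by at least 1. Since Psi
    oscillates by at most 2M times the total weight of the cliques, and this
    total is at most D times that of the vertices, the bound follows. *)
Require Import Defs.
From mathcomp Require Import all_boot all_order all_algebra.
From mathcomp Require Import all_classical all_reals all_analysis.
From mathcomp Require Import ring lra.

Set Implicit Arguments.
Unset Strict Implicit.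
Unset Printing Implicit Defensive.

Import Order.TTheory GRing.Theory Num.Theory.
Import numFieldNormedType.Exports.

Local Open Scope ring_scope.

(** * Distances, geometric vertex weights and a weighted sum inequality *)

Lemma has_walk0 (V : finType) (e : rel V) (x : V) : has_walk e 0 x x.
Proof. by apply/existsP; exists [tuple]; rewrite /= eqxx. Qed.

Lemma has_walk_rcons (V : finType) (e : rel V) (r : nat) (x y z : V) :
  has_walk e r x y -> e y z -> has_walk e r.+1 x z.
Proof.
move=> /existsP[p /andP[xp /eqP yE]] yz; apply/existsP.
exists [tuple of rcons p z] => /=.
by rewrite rcons_path xp yE yz last_rcons eqxx.
Qed.

Lemma connect_at_dist (V : finType) (e : rel V) (x y : V) :
  connect e x y -> exists r, at_dist e r x y.
Proof.
move=> /connectP[p xp yE].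
have walkP : exists r, has_walk e r x y.
  exists (size p); apply/existsP; exists (in_tuple p) => /=.
  by rewrite xp yE eqxx.
case: (ex_minnP walkP) => r xy rmin; exists r; rewrite /at_dist xy /=.
apply/forallP => s; apply/negP => /rmin; by rewrite leqNgt ltn_ord.
Qed.

Lemma at_dist_edge (V : finType) (e : rel V) (r s : nat) (x y z : V) :
  at_dist e r x y -> at_dist e s x z -> e y z -> (s <= r.+1)%N.
Proof.
move=> /andP[xy _] /andP[_ /forallP smin] yz; rewrite leqNgt; apply/negP => rs.
by have /negP := smin (Ordinal rs); apply; apply: has_walk_rcons yz.
Qed.

Lemma sphere_size_sum (V : finType) (e : rel V) (k : V) (r : nat) :
  sphere_size e k r = (\sum_v at_dist e r k v)%N.
Proof.
rewrite /sphere_size -sum1_card big_mkcond /=.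
by apply: eq_bigr => v _; rewrite inE; case: at_dist.
Qed.

(** The weight is [q ^+ d v] on the component of [k] and 0 elsewhere. An edge raises the distance by
    at most one and, [e] being symmetric, stays within a component. The total is compared with a
    finite partial sum, so that the infinite series enters only at the very end. *)
Lemma geometric_weight_exists (R : realFieldType) (V : finType) (e : rel V)
    (e_sym : symmetric e) (k : V) (q : R) (q01 : 0 <= q <= 1) :
  exists w : V -> R,
    [/\ w k = 1, (forall v, 0 <= w v <= 1),
        (forall i j, e i j -> q * w i <= w j) &
        exists N, \sum_v w v <=
          \sum_(0 <= r < N) q ^+ r * (sphere_size e k r)%:R].
Proof.
case/andP: q01 => q0 q1.
have /choice[d dP] : forall v, exists r, connect e k v -> at_dist e r k v.
  move=> v; case: (boolP (connect e k v)) => [/connect_at_dist[r rP]|_].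
    by exists r.
  (* An unreachable vertex gets a dummy value, masked below by the weight 0. *)
  by exists 0.
exists (fun v => if connect e k v then q ^+ d v else 0); split.
- rewrite connect0; suff -> : d k = 0%N by [].
  have /andP[_ /forallP dmin] := dP k (connect0 _ _).
  apply/eqP; rewrite -leqn0 leqNgt; apply/negP => d0.
  by have := dmin (Ordinal d0); rewrite has_walk0.
- move=> v; case: ifP => _; last by rewrite lexx ler01.
  by rewrite exprn_ge0 // exprn_ile1.
- move=> i j ij.
  have kj : connect e k i = connect e k j.
    apply/idP/idP => h; first exact: connect_trans h (connect1 ij).
    by apply: connect_trans h (connect1 _); rewrite e_sym.
  rewrite -kj; case: ifP => ki; last by rewrite mulr0.
  rewrite -exprS ler_wiXn2l //; apply: at_dist_edge (ij); first exact: dP.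
  by apply: dP; rewrite -kj.
(* This [N] exceeds every [d v], so after exchanging the sums the term [r = d v] occurs for each
   reachable [v] and alone accounts for its weight. *)
- exists (\max_v d v).+1.
  under [leRHS]eq_bigr => r _ do rewrite sphere_size_sum natr_sum mulr_sumr.
  rewrite exchange_big /=; apply: ler_sum => v _; case: ifP => kv; last first.
    by apply: sumr_ge0 => r _; rewrite mulr_ge0 ?exprn_ge0.
  have dN : (d v < (\max_v d v).+1)%N by rewrite ltnS leq_bigmax.
  rewrite big_mkord (bigD1 (Ordinal dN)) //= dP // mulr1 lerDl.
  by apply: sumr_ge0 => r _; rewrite mulr_ge0 ?exprn_ge0.
Qed.

(* Splitting [W] as its minimum plus a remainder, the minimum multiplies a total
   gain of at least 1 and the remainder vanishes on at least one index, so at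
   most [D - 1] terms can be negative. This saving of one term is what allows
   [q = 1 - 1 / (2DM)] rather than [q = 1 / (1 + 1 / (2DM))]. *)
Lemma weighted_sum_ge0 (R : realFieldType) (I : finType) (A : {set I})
    (W delta : I -> R) (w q M : R) (D : nat) :
  (#|A| <= D)%N -> 1 <= M -> 0 < D%:R * M -> q = 1 - 1 / (2 * D%:R * M) ->
  0 <= w ->
  (forall C, C \in A -> w <= W C /\ q * W C <= w) ->
  (forall C, C \in A -> `|delta C| <= 2 * M) ->
  1 <= \sum_(C in A) delta C ->
  0 <= \sum_(C in A) W C * delta C.
Proof.
move=> AD M1 DM0 qE w0 WP deltaP gain.
have [A0|[C1 C1A]] := set_0Vmem A.
  by rewrite A0 big_set0.
have D1 : 1 <= D%:R :> R.
  by rewrite ler1n (leq_trans _ AD) // card_gt0; apply/set0Pn; exists C1.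
have qDM : 2 * D%:R * M * (1 - q) = 1.
  rewrite qE; field; apply/andP; split; lra.
have q_lt1 : 0 < 1 - q.
  by rewrite qE opprB addrCA subrr addr0 divr_gt0 // -mulrA mulr_gt0.
have q0 : 0 < q by nra.
case: (arg_minP W C1A) => C0 C0A C0min.
(* The upper bounds on the weights read [q * W C <= w], so the sum is scaled by [q > 0] before it is
   split. *)
rewrite -(pmulr_rge0 _ q0).
have -> : q * \sum_(C in A) W C * delta C =
    q * W C0 * (\sum_(C in A) delta C) +
    \sum_(C in A) q * (W C - W C0) * delta C.
  by rewrite !mulr_sumr -big_split; apply: eq_bigr => C _ /=; ring.
rewrite (bigD1 C0) //= [in X in _ + X](bigD1 C0) //= subrr mulr0 mul0r add0r.
rewrite -(bigD1 C0) //=.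
(* From [w <= W C0] and [q * W C <= w] follows [q * (W C - W C0) <= (1 - q) * w], and each [delta C]
   is at least [- (2 * M)]. *)
have rem : - ((D%:R - 1) * ((1 - q) * w * (2 * M))) <=
    \sum_(C in A | C != C0) q * (W C - W C0) * delta C.
  rewrite -[leRHS]opprK lerN2 -sumrN.
  apply: (@le_trans _ _ (\sum_(C in A | C != C0) (1 - q) * w * (2 * M))).
    apply: ler_sum => C /andP[CA _].
    have [wC qC] := WP _ CA; have [wC0 qC0] := WP _ C0A.
    have := C0min _ CA; have := deltaP _ CA; rewrite ler_norml => /andP[dl _].
    move=> WC.
    apply: (@le_trans _ _ (q * (W C - W C0) * (2 * M))).
      rewrite -mulrN ler_wpM2l //; [nra|lra].
    by rewrite ler_wpM2r //; nra.
  rewrite sumr_const -[leLHS]mulr_natl ler_wpM2r //.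
    by rewrite !mulr_ge0 //; lra.
  rewrite (eq_card (B := A :\ C0)); last first.
    by move=> C; rewrite !inE andbC.
  move: AD; rewrite (cardsD1 C0 A) (C0A : C0 \in A) add1n.
  by rewrite lerBrDr natr1 ler_nat.
have [wC0 _] := WP _ C0A.
have : q * w <= q * W C0 * \sum_(C in A) delta C.
  apply: (@le_trans _ _ (q * W C0)); first by rewrite ler_wpM2l // ltW.
  by rewrite ler_peMr // mulr_ge0 ?(ltW q0) ?(le_trans w0).
(* This is the final balance: [q * w] from the minimum, minus the bound on the remainder, equals
   exactly this product. *)
have : 0 <= w * (1 - q) * (2 * M - 1) by rewrite !mulr_ge0 //; lra.
have : (D%:R - 1) * ((1 - q) * w * (2 * M)) = w - 2 * M * (1 - q) * w.
  transitivity (2 * D%:R * M * (1 - q) * w - 2 * M * (1 - q) * w); first ring.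
  by rewrite qDM mul1r.
lra.
Qed.

(** * Weighted potentials and their change under one update *)

Definition cliques_at (V : finType) (e : rel V) (i : V) : {set {set V}} :=
  [set C in max_cliques e | i \in C].

Lemma card_cliques_at_le (V : finType) (e : rel V) (i : V) :
  (#|cliques_at e i| <= clique_degree e)%N.
Proof. exact: (leq_bigmax (F := fun v => #|cliques_at e v|)). Qed.

(** The weights are left arbitrary so that one difference formula serves both Psi, with
    [clique_weight w], and the potential itself, with constant weight 1. *)
Definition weighted_potential (R : realType) (V : finType) (S : V -> finType)
    (e : rel V) (phi : local_potentials R S) (W : {set V} -> R)
    (a : profile S) : R :=
  \sum_(C in max_cliques e) W C * phi C (Defs.restrict C a).

Lemma restrict_agree_off (V : finType) (S : V -> finType) (i : V)
    (a b : profile S) (C : {set V}) :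
  agree_off i a b -> i \notin C -> Defs.restrict C a = Defs.restrict C b.
Proof.
move=> /forallP ab iC; apply/ffunP => -[j jC]; rewrite !ffunE /=.
apply/eqP; have /implyP := ab j; apply.
by apply: contraNneq iC => <-.
Qed.

Lemma weighted_potential_diff (R : realType) (V : finType) (S : V -> finType)
    (e : rel V) (phi : local_potentials R S) (W : {set V} -> R)
    (i : V) (a b : profile S) :
  agree_off i a b ->
  weighted_potential e phi W b - weighted_potential e phi W a =
  \sum_(C in cliques_at e i)
     W C * (phi C (Defs.restrict C b) - phi C (Defs.restrict C a)).
Proof.
move=> ab; rewrite /weighted_potential -sumrB.
rewrite (bigID (fun C : {set V} => i \in C)) /=.
rewrite [X in _ + X]big1 ?addr0 => [|C /andP[_ iC]]; last first.
  by rewrite (restrict_agree_off ab iC) subrr.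
by apply: eq_big => [C|C _]; rewrite ?inE // mulrBr.
Qed.

(** The default 0 of the maximum is harmless because vertex weights are nonnegative. *)
Definition clique_weight (R : realFieldType) (V : finType) (w : V -> R)
    (C : {set V}) : R :=
  \big[Num.max/0]_(v in C) w v.

(** Any other vertex of [C] is adjacent to [i], so a single use of the edge inequality bounds its
    weight. Multiplying by [q] instead of dividing allows [q = 0]. *)
Lemma clique_weight_bounds (R : realFieldType) (V : finType) (e : rel V)
    (w : V -> R) (q : R) (i : V) (C : {set V}) :
  0 <= q <= 1 -> (forall v, 0 <= w v) ->
  (forall x y, e x y -> q * w x <= w y) ->
  symmetric e -> C \in cliques_at e i ->
  w i <= clique_weight w C /\ q * clique_weight w C <= w i.
Proof.
move=> /andP[q0 q1] w0 we e_sym; rewrite !inE => /andP[/maxsetp cC iC].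
split; first exact: le_bigmax_cond.
apply: (big_ind (fun x => q * x <= w i)); first by rewrite mulr0.
  by move=> x y qx qy; rewrite maxEle; case: ifP.
move=> v vC; have [->|vi] := eqVneq v i; first by rewrite ler_piMl.
apply: we; have /forallP/(_ v)/implyP/(_ vC)/forallP/(_ i)/implyP := cC.
by move=> /(_ iC)/implyP; apply.
Qed.

(** A maximum of nonnegative weights is at most their sum, and exchanging the sums counts each
    vertex once per maximal clique through it. *)
Lemma sum_clique_weights_le (R : realFieldType) (V : finType) (e : rel V)
    (w : V -> R) (w0 : forall v, 0 <= w v) :
  \sum_(C in max_cliques e) clique_weight w C <=
  (clique_degree e)%:R * \sum_v w v.
Proof.
apply: (@le_trans _ _ (\sum_(C in max_cliques e) \sum_(v in C) w v)).
  apply: ler_sum => C _; apply: bigmax_le; first exact: sumr_ge0.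
  by move=> v vC; rewrite (bigD1 v) //= lerDl sumr_ge0.
rewrite (exchange_big_dep predT) //= mulr_sumr; apply: ler_sum => v _.
rewrite sumr_const -[leLHS]mulr_natl ler_wpM2r // ler_nat.
rewrite (eq_card (B := cliques_at e v)) => [|C]; last by rewrite [RHS]inE.
exact: card_cliques_at_le.
Qed.

(** The indicator merges two claims: Psi never decreases, and it gains at least 1 when [k]
    updates. *)
Lemma update_weighted_potential (R : realType) (V : finType) (e : rel V)
    (S : V -> finType) (u : V -> profile S -> R) (Phi : profile S -> R)
    (phi : local_potentials R S) (M q : R) (w : V -> R) (k i : V)
    (a b : profile S) :
  symmetric e -> is_potential u Phi -> decomposes e Phi phi ->
  integral_local_potentials e phi -> bounded_local_potentials e phi M ->
  1 <= 2 * (clique_degree e)%:R * M ->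
  q = 1 - 1 / (2 * (clique_degree e)%:R * M) ->
  w k = 1 -> (forall v, 0 <= w v <= 1) ->
  (forall x y, e x y -> q * w x <= w y) ->
  better_response u i a b ->
  (i == k)%:R <= weighted_potential e phi (clique_weight w) b -
                 weighted_potential e phi (clique_weight w) a.
Proof.
move=> e_sym pot dec int bnd DM_ge qE wk w01 we /and3P[ab _ uab].
have w0 v : 0 <= w v by case/andP: (w01 v).
have mcP C : C \in cliques_at e i -> C \in max_cliques e.
  by rewrite [in X in X -> _]inE => /andP[].
rewrite (weighted_potential_diff e phi _ ab).
pose delta C := phi C (Defs.restrict C b) - phi C (Defs.restrict C a).
have PhiE x : Phi x = weighted_potential e phi (fun=> 1) x.
  by rewrite dec; apply: eq_bigr => C _; rewrite mul1r.
have sumE : \sum_(C in cliques_at e i) delta C = Phi b - Phi a.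
  rewrite !PhiE (weighted_potential_diff e phi _ ab).
  by apply: eq_bigr => C _; rewrite mul1r.
have delta_int C : C \in cliques_at e i -> delta C \is a Num.int.
  by move=> /mcP CA; rewrite rpredB ?int.
have gain : 1 <= \sum_(C in cliques_at e i) delta C.
  have gain0 : 0 < \sum_(C in cliques_at e i) delta C.
    by rewrite sumE -(pot _ _ _ ab) subr_gt0.
  by rewrite -(gtr0_norm gain0) norm_intr_ge1 ?rpred_sum ?gt_eqF.
have deltaM C : C \in cliques_at e i -> `|delta C| <= 2 * M.
  move=> /mcP CA; rewrite mulr_natl mulr2n.
  by rewrite (le_trans (ler_normB _ _)) // lerD // bnd.
(* At [k] the weights of the cliques are squeezed between [w k = 1] and the global bound 1, so Psi
   changes exactly as the potential does. *)
have [ik|ik] := eqVneq i k.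
  apply: (le_trans gain); apply: ler_sum => C CA.
  suff -> : clique_weight w C = 1 by rewrite mul1r.
  apply: le_anti; apply/andP; split.
    by apply: bigmax_le => // v _; case/andP: (w01 v).
  rewrite -wk -ik; apply: le_bigmax_cond.
  by move: CA; rewrite inE => /andP[].
(* An integral local potential bounded by [M < 1] vanishes, so no update could
   occur. *)
have M1 : 1 <= M.
  rewrite leNgt; apply/negP => M1; move: gain; rewrite big1 ?ler10 // => C CA.
  have phi0 x : phi C x = 0.
    apply/eqP; apply/negPn/negP => /(norm_intr_ge1 (int _ (mcP _ CA) x)).
    by rewrite leNgt (le_lt_trans (bnd _ (mcP _ CA) x) M1).
  by rewrite /delta !phi0 subrr.
have q01 : 0 <= q <= 1.
  rewrite qE; apply/andP; split.
    by rewrite subr_ge0 ler_pdivrMr ?mul1r // (lt_le_trans ltr01).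
  by rewrite gerBl divr_ge0 // (le_trans ler01).
apply: (@weighted_sum_ge0 _ _ _ _ _ (w i) q M (clique_degree e)) => //.
- exact: card_cliques_at_le.
- lra.
- by move=> C CA; apply: clique_weight_bounds CA.
Qed.

(** * Counting updates along a path *)

Lemma num_updates_sum (R : realType) (V : finType) (S : V -> finType)
    (u : V -> profile S -> R) (a : nat -> profile S) (L : nat) (k : V) :
  num_updates u a L k =
  (\sum_(0 <= t < L) better_response u k (a t) (a t.+1))%N.
Proof.
rewrite /num_updates -sum1_card big_mkord big_mkcond /=.
by apply: eq_bigr => t _; rewrite inE; case: better_response.
Qed.

Lemma weighted_potential_osc (R : realType) (V : finType) (S : V -> finType)
    (e : rel V) (phi : local_potentials R S) (W : {set V} -> R) (M : R)
    (a b : profile S) :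
  bounded_local_potentials e phi M -> (forall C, 0 <= W C) ->
  weighted_potential e phi W b - weighted_potential e phi W a <=
  2 * M * \sum_(C in max_cliques e) W C.
Proof.
move=> bnd W0; rewrite /weighted_potential -sumrB mulr_sumr.
apply: ler_sum => C CA; rewrite -mulrBr mulrC ler_wpM2r // mulr_natl mulr2n.
by rewrite (le_trans (ler_norm _)) // (le_trans (ler_normB _ _)) // lerD // bnd.
Qed.

Theorem theorem5p3 (R : realType) (V : finType) (e : rel V)
    (e_sym : symmetric e) (e_irr : irreflexive e)
    (S : V -> finType) (u : V -> profile S -> R)
    (Phi : profile S -> R) (phi : local_potentials R S) (M : R)
    (u_graphical : graphical_game e u)
    (u_potential : is_potential u Phi)
    (Phi_decomp : decomposes e Phi phi)
    (phi_integral : integral_local_potentials e phi)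
    (phi_bounded : bounded_local_potentials e phi M)
    (DM_ge : 1 <= 2 * (clique_degree e)%:R * M)
    (a : nat -> profile S) (L : nat) (a_path : better_response_path u a L)
    (k : V) :
  ((num_updates u a L k)%:R%:E <=
    (2 * (clique_degree e)%:R * M)%:E *
    \sum_(0 <= r <oo)
      ((1 - 1 / (2 * (clique_degree e)%:R * M)) ^+ r *
       (sphere_size e k r)%:R)%:E)%E.
Proof.
set D : R := (clique_degree e)%:R; set q := 1 - _.
have DM0 : 0 < 2 * D * M by apply: lt_le_trans DM_ge.
have M0 : 0 <= M.
  rewrite leNgt; apply/negP => M0; move: DM0; rewrite ltNge.
  by rewrite mulr_ge0_le0 ?mulr_ge0 // ltW.
(* The lower bound is [DM_ge]; equality there gives [q = 0]. *)
have q01 : 0 <= q <= 1.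
  apply/andP; split; first by rewrite subr_ge0 ler_pdivrMr ?mul1r.
  by rewrite gerBl divr_ge0 // ltW.
have [w [wk w01 we [N wN]]] := geometric_weight_exists e_sym k q01.
have w0 v : 0 <= w v by case/andP: (w01 v).
pose W := clique_weight w.
have W0 C : 0 <= W C by apply: bigmax_ge_id.
pose Psi := weighted_potential e phi W.
have upd_le : (num_updates u a L k)%:R <= Psi (a L) - Psi (a 0).
  rewrite num_updates_sum natr_sum
    -(telescope_sumr (fun t => Psi (a t))) // !big_mkord.
  apply: ler_sum => t _; have [brk|_] := boolP (better_response u k _ _).
    have := update_weighted_potential (k := k) e_sym
      u_potential Phi_decomp phi_integral phi_bounded DM_ge erefl wk w01 we brk.
    by rewrite eqxx.
  (* A step that is not counted is still an update of some player, so Psi does not decrease. *)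
  have [i bri] := a_path t (ltn_ord t).
  apply: le_trans (update_weighted_potential (k := k) e_sym
    u_potential Phi_decomp phi_integral phi_bounded DM_ge erefl wk w01 we bri).
  exact: ler0n.
have partial : (num_updates u a L k)%:R <=
    2 * D * M * \sum_(0 <= r < N) q ^+ r * (sphere_size e k r)%:R.
  apply: (le_trans upd_le).
  apply: (le_trans (weighted_potential_osc _ _ phi_bounded W0)).
  have -> (x : R) : 2 * D * M * x = 2 * M * (D * x) by ring.
  rewrite ler_wpM2l ?mulr_ge0 // (le_trans (sum_clique_weights_le e w0)) //.
  by rewrite ler_wpM2l.
apply: (@le_trans _ _ ((2 * D * M)%:E *
    \sum_(0 <= r < N) (q ^+ r * (sphere_size e k r)%:R)%:E)%E).
  by rewrite sumEFin -EFinM lee_fin.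
(* The terms being nonnegative, the partial sum lies below the series. *)
rewrite lee_wpmul2l ?lee_fin ?(ltW DM0) //.
apply: nneseries_lim_ge => r _ _.
by case/andP: q01 => q0 _; rewrite lee_fin mulr_ge0 // exprn_ge0.
Qed.
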